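(* Let $\mathscr S$ be an algebraic signature. Then $\omega_{\mathscr S}$ consists of exactly those $x$ in $\mathrm{ON}_{\mathscr S}$ such that neither $x$ nor any element of $\mathscr G(x)$ is a limit.
   Context: We work in axiomatic set theory (Zermelo–Fraenkel with Choice and Foundation); classes are allowed, $\mathbf V$ is the class of all sets, and $\omega$ is the set of von Neumann natural numbers. An algebraic signature $\mathscr S$ is a class of function-symbols, each with an arity in $\omega$ (arity $0$ allowed). An algebra with signature $\mathscr S$ is a class $C$ with, for each $n$-ary $F\in\mathscr S$, an operation $F^{C}:C^n\to C$. Homomorphisms are functions commuting with these operations. Tuples: an $(n+1)$-tuple $(x_0,\dots,x_n)$ (with $n\in\omega$) is the function $i\mapsto x_i$ on $\{0,\dots,n\}$ (ordered pairs being Kuratowski pairs $\{\{a\},\{a,b\}\}$). Its type is $x_n$. For $x=(x_0,\dots,x_n)$ and $k\in\omega$, $\operatorname{pred}_k(x)=x_k$ if $k<n$, and $\operatorname{pred}_k(x)=\emptyset$ if $k\ge n$; if $x$ is not such a tuple, all $\operatorname{pred}_k(x)$ are empty. Put $\mathscr G(x)=\bigcup\{\operatorname{pred}_k(x):k\in\omega\}$, and write $y\in' x$ for $y\in\mathscr G(x)$. Say $x$ is $k$-transitive if $y\in\operatorname{pred}_k(x)$ implies $\mathscr G(y)\subseteq\operatorname{pred}_k(x)$. $\mathbf D_{\mathscr S}$ is the class of all $x$ such that: (1) for some $n\in\omega$, $x$ is an $(n+1)$-tuple whose type is an $n$-ary element of $\mathscr S$, and $\operatorname{pred}_k(x)\neq\emptyset$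 whenever $k<n$; (2) for each $y\in\mathscr G(x)$, for some $m\in\omega$, $y$ is an $(m+1)$-tuple whose type is an $m$-ary element of $\mathscr S$, and $\operatorname{pred}_\ell(y)\ne\emptyset$ whenever $\ell<m$; (3) $x$ is $k$-transitive for each $k\in\omega$; (4) each element of $\mathscr G(x)$ is $k$-transitive for each $k\in\omega$. $\in'$ directs a set if every nonempty finite subset has an upper bound in the set, that is, an element $u$ of the set such that $a=u$ or $a\in' u$ for every $a$ in the subset. $\mathrm{ON}_{\mathscr S}$ is the class of $x\in\mathbf D_{\mathscr S}$ such that: (5) $\in'$ directs each set $\operatorname{pred}_k(x)$, $k\in\omega$; (6) $\in'$ directs each set $\operatorname{pred}_\ell(y)$, $\ell\in\omega$, for each $y\in\mathscr G(x)$; (7) $\in'$ is well-founded on $\mathscr G(x)$, that is, every nonempty subset $b$ of $\mathscr G(x)$ has an element $d$ with no $z\in b$ such that $z\in' d$. An element $x$ of $\mathbf D_{\mathscr S}$ is a limit if some nonempty set $\operatorname{pred}_k(x)$ has no maximal element with respect to $\in'$ (an element $m$ of a set is maximal if there is no $b$ in the set with $m\in' b$). $\mathbf V$ is made into an $\mathscr S$-algebra by $F^{\mathbf V}(x_0,\dots,x_{n-1})=(\mathscr G(x_0)\cup\{x_0\},\dots,\mathscr G(x_{n-1})\cup\{x_{n-1}\},F)$ for each $n$-ary $F\in\mathscr S$. Let $\mathrm{Tm}^0(\mathscr S)$ be the algebra of closed terms of $\mathscr S$ in Polish notation: the smallest class of finite strings of symbols of $\mathscr S$ that contains $Ft_0\cdots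 t_{n-1}$ whenever $F\in\mathscr S$ is $n$-ary and it contains $t_0,\dots,t_{n-1}$, with operations $(t_0,\dots,t_{n-1})\mapsto Ft_0\cdots t_{n-1}$; it is the free $\mathscr S$-algebra (unique homomorphism to every $\mathscr S$-algebra). Then $\omega_{\mathscr S}$ is defined as the homomorphic image of $\mathrm{Tm}^0(\mathscr S)$ in $\mathbf V$. *)

(* Defs.v *)
From Stdlib Require Import ClassicalEpsilon.

Set Implicit Arguments.
Unset Strict Implicit.
Unset Printing Implicit Defensive.

(* A universe of sets satisfying ZFC.  Classes are predicates on the universe,
   and class functions are Rocq functions or functional relations on it;
   Separation and Replacement are accordingly stated for all classes. *)
Record ZFC := {
  sets :> Type;
  mem : sets -> sets -> Prop;
  extensionality : forall x y, (forall z, mem z x <-> mem z y) -> x = y;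
  pairing : forall x y, exists p, forall z, mem z p <-> z = x \/ z = y;
  union : forall x, exists u, forall z, mem z u <-> exists y, mem y x /\ mem z y;
  powerset : forall x, exists p, forall z,
    mem z p <-> (forall w, mem w z -> mem w x);
  infinity : exists x,
    (exists e, mem e x /\ forall z, ~ mem z e) /\
    (forall y, mem y x ->
      exists s, mem s x /\ forall z, mem z s <-> mem z y \/ z = y);
  separation : forall (P : sets -> Prop) x, exists y, forall z,
    mem z y <-> mem z x /\ P z;
  replacement : forall (R : sets -> sets -> Prop) x,
    (forall y z z', mem y x -> R y z -> R y z' -> z = z') ->
    exists i, forall z, mem z i <-> exists y, mem y x /\ R y z;
  foundation : forall x, (exists y, mem y x) ->
    exists y, mem y x /\ forall z, mem z x -> ~ mem z y;
  choice : forall x,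
    (forall y, mem y x -> exists z, mem z y) ->
    (forall y y' z, mem y x -> mem y' x -> mem z y -> mem z y' -> y = y') ->
    exists c, forall y, mem y x -> exists! z, mem z y /\ mem z c
}.

Notation "x ∈ y" := (mem x y) (at level 70, no associativity).

Lemma sets_inhabited (V : ZFC) : inhabited V.
Proof. destruct (infinity V) as [x _]. exact (inhabits x). Qed.

Section SetTheory.

Variable V : ZFC.

(* Used only for properties with exactly one witness. *)
Definition the (P : V -> Prop) : V := epsilon (sets_inhabited V) P.

(* The set {y | P y}; meaningful only when the class P is a set. *)
Definition setof (P : V -> Prop) : V := the (fun x => forall y, y ∈ x <-> P y).

Definition subset (x y : V) := forall z, z ∈ x -> z ∈ y.
Definition empty : V := setof (fun _ => False).
Definition upair (a b : V) : V := setof (fun z => z = a \/ z = b).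
Definition singleton (a : V) : V := upair a a.
Definition cup (a b : V) : V := setof (fun z => z ∈ a \/ z ∈ b).
Definition opair (a b : V) : V := upair (singleton a) (upair a b).

Definition succ (n : V) : V := cup n (singleton n).
Definition inductive_set (I : V) :=
  empty ∈ I /\ forall n, n ∈ I -> succ n ∈ I.
Definition omega : V := setof (fun n => forall I, inductive_set I -> n ∈ I).

(* [f], as a set of ordered pairs, is a function with domain [d]. *)
Definition function_on (d f : V) :=
  (forall p, p ∈ f -> exists i y, i ∈ d /\ p = opair i y) /\
  (forall i, i ∈ d -> exists! y, opair i y ∈ f).
Definition app (f i : V) : V := the (fun y => opair i y ∈ f).
Definition dom (f : V) : V := setof (fun i => exists y, opair i y ∈ f).
Definition lam (d : V) (g : V -> V) : V :=
  setof (fun p => exists i, i ∈ d /\ p = opair i (g i)).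

Definition finite (b : V) :=
  exists n f, n ∈ omega /\ function_on n f /\
    (forall i, i ∈ n -> app f i ∈ b) /\
    (forall y, y ∈ b -> exists! i, i ∈ n /\ app f i = y).

(* The value at [k] of the function on omega given by 0 |-> a and
   i + 1 |-> g i (value at i), via its restriction to k + 1. *)
Definition omega_rec (a : V) (g : V -> V -> V) (k : V) : V :=
  the (fun v => exists f, function_on (succ k) f /\
    app f empty = a /\
    (forall i, i ∈ k -> app f (succ i) = g i (app f i)) /\
    app f k = v).

Definition add (m n : V) : V := omega_rec m (fun _ v => succ v) n.

(* A string is a function whose domain, its length, is in omega. *)
Definition letter (F : V) : V := singleton (opair empty F).
Definition concat (s t : V) : V :=
  cup s (setof (fun p => exists j y,
    opair j y ∈ t /\ p = opair (add (dom s) j) y)).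
(* t_0 t_1 ... t_(n-1) *)
Definition concat_all (t n : V) : V :=
  omega_rec empty (fun k s => concat s (app t k)) n.

(* [x] is an (n+1)-tuple. *)
Definition is_tuple (n x : V) := function_on (succ n) x.

Definition pred (k x : V) : V :=
  if excluded_middle_informative
       (exists n, n ∈ omega /\ is_tuple n x /\ k ∈ n)
  then app x k else empty.

Definition G (x : V) : V := setof (fun y => exists k, k ∈ omega /\ y ∈ pred k x).

(* The relation ∈'. *)
Definition mem' (y x : V) := y ∈ G x.

Definition transitive_at (k x : V) :=
  forall y, y ∈ pred k x -> subset (G y) (pred k x).

Definition directed (a : V) :=
  forall b, subset b a -> b <> empty -> finite b ->
    exists u, u ∈ a /\ forall c, c ∈ b -> c = u \/ mem' c u.

Definition well_founded_on (a : V) :=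
  forall b, subset b a -> b <> empty ->
    exists d, d ∈ b /\ ~ exists z, z ∈ b /\ mem' z d.

Definition maximal_in (a m : V) := m ∈ a /\ ~ exists b, b ∈ a /\ mem' m b.

(* The value of [arity] outside the class [symbol] is never used. *)
Record signature := {
  symbol : V -> Prop;
  arity : V -> V;
  arity_omega : forall F, symbol F -> arity F ∈ omega
}.

(* [a] is an element of C^n. *)
Definition power (C : V -> Prop) (n a : V) :=
  function_on n a /\ forall i, i ∈ n -> C (app a i).

Variable S : signature.

Record algebra := {
  carrier : V -> Prop;
  op : V -> V -> V;
  op_closed : forall F a, symbol S F -> power carrier (arity S F) a ->
    carrier (op F a)
}.

Definition homomorphism (A B : algebra) (h : V -> V) :=
  (forall x, carrier A x -> carrier B (h x)) /\
  (forall F a, symbol S F -> power (carrier A) (arity S F) a ->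
    h (op A F a) = op B F (lam (arity S F) (fun i => h (app a i)))).

Definition well_typed (x : V) :=
  exists n, n ∈ omega /\ is_tuple n x /\
    symbol S (app x n) /\ arity S (app x n) = n /\
    forall k, k ∈ n -> pred k x <> empty.

Definition D (x : V) :=
  well_typed x /\
  (forall y, y ∈ G x -> well_typed y) /\
  (forall k, k ∈ omega -> transitive_at k x) /\
  (forall y, y ∈ G x -> forall k, k ∈ omega -> transitive_at k y).

Definition ON (x : V) :=
  D x /\
  (forall k, k ∈ omega -> directed (pred k x)) /\
  (forall y, y ∈ G x -> forall l, l ∈ omega -> directed (pred l y)) /\
  well_founded_on (G x).

Definition limit (x : V) :=
  D x /\ exists k, k ∈ omega /\ pred k x <> empty /\
    ~ exists m, maximal_in (pred k x) m.

Definition V_op (F a : V) : V :=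
  cup (lam (arity S F) (fun i => cup (G (app a i)) (singleton (app a i))))
      (singleton (opair (arity S F) F)).

Definition V_algebra : algebra :=
  {| carrier := fun _ => True; op := V_op; op_closed := fun _ _ _ _ => I |}.

Definition polish (F t : V) : V :=
  concat (letter F) (concat_all t (arity S F)).

Inductive Tm0 : V -> Prop :=
| Tm0_op F t : symbol S F -> function_on (arity S F) t ->
    (forall i, i ∈ arity S F -> Tm0 (app t i)) -> Tm0 (polish F t).

Lemma Tm0_closed F t : symbol S F -> power Tm0 (arity S F) t -> Tm0 (polish F t).
Proof. intros HF [Hf Ht]. exact (Tm0_op HF Hf Ht). Qed.

Definition Tm0_algebra : algebra :=
  {| carrier := Tm0; op := polish; op_closed := Tm0_closed |}.

(* The image of the homomorphism from Tm0 to V, which is unique on Tm0. *)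
Definition omega_sig (x : V) :=
  exists h, homomorphism Tm0_algebra V_algebra h /\ exists t, Tm0 t /\ h t = x.

End SetTheory.

(* Main.v *)
From Stdlib Require Import List Lia ClassicalEpsilon.
Require Import Defs.
Import ListNotations.

Set Implicit Arguments.
Unset Strict Implicit.
Unset Printing Implicit Defensive.

(** Call a tuple regular if it is well typed and each of its predecessor sets
    is transitive for the relation y ∈ G x, directed, and, when nonempty, has a
    maximal element.  Because G y ⊆ G x for y ∈ G x, the right-hand side of the
    theorem says that x and all elements of G x are regular and that the
    relation is well founded on G x ([hereditarily_regular_iff]).

    The key observation is [regular_V_op]: a maximal element m of a directed
    set p is its greatest element, and if p is transitive then p = G m ∪ {m}.
    This is the shape of the components of a value of an operation of the
    algebra V, so every regular tuple is such a value, at arguments taken from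
    G x.  A minimal element of G x that is not generated from nothing by the
    operations is therefore impossible, and x is generated
    ([hereditarily_regular_generated]).  Conversely each operation preserves
    hereditary regularity ([generated_hereditarily_regular]): in the new
    tuple, a_k is the greatest element of the k-th predecessor set, strictly
    so because a_k ∉ G a_k by well-foundedness.

    It remains to see that the image of the term algebra consists of the sets
    generated by the operations ([omega_sig_generated]).  Only the existence of
    a homomorphism is a question; it is the existence of a well-defined
    evaluation of strings, that is, unique readability of Polish notation
    ([polish_inj]).  The internal natural numbers and finite strings are in
    bijection with the types nat and list V, and unique readability is proved
    for lists, by reading from left to right and counting how many terms are
    still expected. *)

(** * Sets and functions *)

Section Universe.

Variable V : ZFC.

Lemma the_eq (P : V -> Prop) v : P v -> (forall w, P w -> w = v) -> the P = v.
Proof.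
  intros Hv Hu. apply Hu. unfold the. apply epsilon_spec. now exists v.
Qed.

Lemma in_setof (P : V -> Prop) :
  (exists x, forall y, y ∈ x <-> P y) -> forall y, y ∈ setof P <-> P y.
Proof. intros H. unfold setof, the. now apply epsilon_spec. Qed.

Lemma setof_eq (P : V -> Prop) x : (forall y, y ∈ x <-> P y) -> setof P = x.
Proof.
  intros H. apply extensionality. intros z.
  rewrite in_setof by now exists x. now rewrite H.
Qed.

Lemma in_empty (x : V) : ~ x ∈ empty V.
Proof.
  unfold empty. rewrite in_setof; [tauto|].
  destruct (separation (fun _ => False) x) as [e He].
  exists e. intros y. rewrite He. tauto.
Qed.

Lemma nonempty_iff (x : V) : x <> empty V <-> exists y, y ∈ x.
Proof.
  split.
  - intros H. apply NNPP. intros N. apply H. apply extensionality.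
    intros z. split; intros Hz; [|now apply in_empty in Hz].
    destruct N. now exists z.
  - intros [y Hy] ->. now apply in_empty in Hy.
Qed.

Lemma in_upair (a b z : V) : z ∈ upair a b <-> z = a \/ z = b.
Proof. apply in_setof. apply pairing. Qed.

Lemma in_singleton (a z : V) : z ∈ singleton a <-> z = a.
Proof. unfold singleton. rewrite in_upair. tauto. Qed.

Lemma in_cup (a b z : V) : z ∈ cup a b <-> z ∈ a \/ z ∈ b.
Proof.
  apply in_setof. destruct (union (upair a b)) as [u Hu].
  exists u. intros y. rewrite Hu. split.
  - intros [w [Hw Hy]]. apply in_upair in Hw. destruct Hw; subst; tauto.
  - intros [H|H]; eexists; rewrite in_upair; eauto.
Qed.

Lemma in_succ (n z : V) : z ∈ succ n <-> z ∈ n \/ z = n.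
Proof. unfold succ. now rewrite in_cup, in_singleton. Qed.

Lemma opair_inj (a b c d : V) : opair a b = opair c d -> a = c /\ b = d.
Proof.
  intros E.
  assert (H : forall z, z = singleton a \/ z = upair a b <->
                        z = singleton c \/ z = upair c d).
  { intros z. rewrite <- !in_upair. change (z ∈ opair a b <-> z ∈ opair c d).
    now rewrite E. }
  assert (Hc : c ∈ singleton a).
  { destruct (proj1 (H (singleton a)) (or_introl eq_refl)) as [-> | ->].
    - now apply in_singleton.
    - apply in_upair. now left. }
  apply in_singleton in Hc. subst c. split; [reflexivity|].
  assert (Hb : b = a \/ b = d).
  { assert (B : b ∈ upair a b) by (apply in_upair; now right).
    destruct (proj1 (H (upair a b)) (or_intror eq_refl)) as [E'|E'];
      rewrite E' in B.
    - apply in_singleton in B. now left.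
    - now apply in_upair in B. }
  assert (Hd : d = a \/ d = b).
  { assert (B : d ∈ upair a d) by (apply in_upair; now right).
    destruct (proj2 (H (upair a d)) (or_intror eq_refl)) as [E'|E'];
      rewrite E' in B.
    - apply in_singleton in B. now left.
    - now apply in_upair in B. }
  destruct Hb, Hd; congruence.
Qed.

Lemma in_image (R : V -> V -> Prop) (x : V) :
  (forall y z z', y ∈ x -> R y z -> R y z' -> z = z') ->
  forall z, z ∈ setof (fun z => exists y, y ∈ x /\ R y z) <->
            exists y, y ∈ x /\ R y z.
Proof. intros H. apply in_setof. now apply replacement. Qed.

Lemma mem_irrefl (x : V) : ~ x ∈ x.
Proof.
  intros H. destruct (@foundation V (singleton x)) as [y [Hy N]].
  - exists x. now apply in_singleton.
  - apply in_singleton in Hy. subst y. apply (N x); [now apply in_singleton|easy].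
Qed.

Lemma app_eq (d f i y : V) : function_on d f -> opair i y ∈ f -> app f i = y.
Proof.
  intros [H1 H2] Hy. unfold app.
  destruct (H1 _ Hy) as [i' [y' [Hi E]]]. apply opair_inj in E.
  destruct E as [<- <-]. destruct (H2 _ Hi) as [w [Hw Hu]].
  apply the_eq; [easy|]. intros w' Hw'. now rewrite <- (Hu w'), <- (Hu y).
Qed.

Lemma opair_app (d f i : V) : function_on d f -> i ∈ d -> opair i (app f i) ∈ f.
Proof.
  intros Hf Hi. destruct (proj2 Hf _ Hi) as [y [Hy _]].
  now rewrite (app_eq Hf Hy).
Qed.

Lemma function_ext (d f g : V) :
  function_on d f -> function_on d g -> (forall i, i ∈ d -> app f i = app g i) ->
  f = g.
Proof.
  assert (H : forall f g, function_on d f -> function_on d g ->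
    (forall i, i ∈ d -> app f i = app g i) -> forall p, p ∈ f -> p ∈ g).
  { intros f' g' Hf Hg E p Hp. destruct (proj1 Hf _ Hp) as [i [y [Hi ->]]].
    rewrite <- (app_eq Hf Hp), E by easy. now apply opair_app with d. }
  intros Hf Hg E. apply extensionality. intros p. split.
  - now apply H.
  - apply H; auto. intros i Hi. symmetry. auto.
Qed.

Lemma function_domain (d d' f : V) : function_on d f -> function_on d' f -> d = d'.
Proof.
  assert (H : forall d d', function_on d f -> function_on d' f ->
    forall i, i ∈ d -> i ∈ d').
  { intros e e' He He' i Hi. pose proof (opair_app He Hi) as Hp.
    destruct (proj1 He' _ Hp) as [j [y [Hj E]]].
    apply opair_inj in E. destruct E as [-> _]. easy. }
  intros H1 H2. apply extensionality. intros i. split; apply H; auto.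
Qed.

Lemma in_lam (d : V) (g : V -> V) p :
  p ∈ lam d g <-> exists i, i ∈ d /\ p = opair i (g i).
Proof. apply (in_image (R := fun i p => p = opair i (g i))). congruence. Qed.

Lemma function_lam (d : V) (g : V -> V) : function_on d (lam d g).
Proof.
  split.
  - intros p Hp. apply in_lam in Hp. destruct Hp as [i [Hi ->]]. eauto.
  - intros i Hi. exists (g i). split; [apply in_lam; eauto|].
    intros y Hy. apply in_lam in Hy. destruct Hy as [j [_ E]].
    apply opair_inj in E. destruct E as [-> ->]. easy.
Qed.

Lemma app_lam (d : V) (g : V -> V) i : i ∈ d -> app (lam d g) i = g i.
Proof.
  intros Hi. apply app_eq with d; [apply function_lam|]. apply in_lam. eauto.
Qed.

(** * Natural numbers and strings *)

(** The von Neumann numerals, with which statements about omega become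
    statements about the type nat. *)
Fixpoint num (k : nat) : V :=
  match k with 0 => empty V | S k => succ (num k) end.

Lemma in_num i n : i ∈ num n <-> exists k, k < n /\ i = num k.
Proof.
  induction n as [|n IH]; simpl.
  - split; [intros H; now apply in_empty in H | intros [k [H _]]; lia].
  - rewrite in_succ, IH. split.
    + intros [[k [H ->]] | ->]; eexists; eauto.
    + intros [k [H ->]]. destruct (PeanoNat.Nat.eq_dec k n) as [->|].
      * now right.
      * left. exists k. split; [lia|easy].
Qed.

Lemma num_in k n : k < n -> num k ∈ num n.
Proof. intros H. apply in_num. eauto. Qed.

Lemma num_inj j k : num j = num k -> j = k.
Proof.
  intros E. destruct (Compare_dec.lt_eq_lt_dec j k) as [[H|H]|H]; [|easy|];
    apply num_in in H; rewrite E in H; now apply mem_irrefl in H.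
Qed.

Lemma inductive_num (I : V) k : inductive_set I -> num k ∈ I.
Proof. intros [H0 HS]. induction k; simpl; auto. Qed.

Lemma inductive_set_exists : exists I : V, inductive_set I.
Proof.
  destruct (infinity V) as [I [[e [He Ne]] HS]]. exists I. split.
  - replace (empty V) with e; [easy|]. apply extensionality.
    intros z. split; intros Hz; [now apply Ne in Hz | now apply in_empty in Hz].
  - intros n Hn. destruct (HS n Hn) as [s [Hs Es]].
    replace (succ n) with s; [easy|]. apply extensionality.
    intros z. now rewrite Es, in_succ.
Qed.

(** Separation holds for every predicate, in particular for being one of the
    numerals [num k]; so the internal omega has no nonstandard elements. *)
Lemma in_omega i : i ∈ omega V <-> exists k, i = num k.
Proof.
  destruct inductive_set_exists as [I HI]. unfold omega. rewrite in_setof.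
  - split.
    + intros H.
      destruct (separation (fun i => exists k, i = num k) I) as [J HJ].
      apply HJ, H. split.
      * apply HJ. split; [apply HI | now exists 0].
      * intros n Hn. apply HJ in Hn. destruct Hn as [Hn [k ->]].
        apply HJ. split; [now apply HI | now exists (S k)].
    + intros [k ->] J HJ. now apply inductive_num.
  - destruct (separation (fun n => forall J, inductive_set J -> n ∈ J) I) as [w Hw].
    exists w. intros n. rewrite Hw. split; [tauto|]. intros H. auto.
Qed.

(** Internal strings have standard finite length, hence are coded by lists. *)
Definition str (l : list V) : V :=
  setof (fun p => exists i y, nth_error l i = Some y /\ p = opair (num i) y).

Lemma in_str l p :
  p ∈ str l <-> exists i y, nth_error l i = Some y /\ p = opair (num i) y.
Proof.
  apply in_setof.
  destruct (@replacement V (fun i p => exists k y,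
    i = num k /\ nth_error l k = Some y /\ p = opair (num k) y) (omega V)) as [s Hs].
  - intros i p1 p2 _ [k1 [y1 [-> [H1 ->]]]] [k2 [y2 [E [H2 ->]]]].
    apply num_inj in E. subst k2. congruence.
  - exists s. intros q. rewrite Hs. split.
    + intros [i [_ [k [y [_ H]]]]]. eauto.
    + intros [k [y H]]. exists (num k). split; [apply in_omega|]; eauto.
Qed.

Lemma opair_in_str l i y : opair (num i) y ∈ str l <-> nth_error l i = Some y.
Proof.
  rewrite in_str. split; [|eauto]. intros [j [z [H E]]].
  apply opair_inj in E. destruct E as [E ->]. apply num_inj in E. now subst j.
Qed.

Lemma str_inj l m : str l = str m -> l = m.
Proof.
  intros E. apply nth_error_ext. intros i.
  assert (H : forall y, nth_error l i = Some y <-> nth_error m i = Some y).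
  { intros y. rewrite <- !opair_in_str. now rewrite E. }
  destruct (nth_error l i) as [y|] eqn:El.
  - symmetry. now apply H.
  - destruct (nth_error m i) as [y|]; [|easy]. now apply H.
Qed.

Lemma function_str l : function_on (num (length l)) (str l).
Proof.
  split.
  - intros p Hp. apply in_str in Hp. destruct Hp as [i [y [H ->]]].
    exists (num i), y. split; [|easy]. apply num_in, nth_error_Some. congruence.
  - intros i Hi. apply in_num in Hi. destruct Hi as [k [Hk ->]].
    apply nth_error_Some in Hk. destruct (nth_error l k) as [y|] eqn:E; [|easy].
    exists y. split; [now apply opair_in_str|].
    intros z Hz. apply opair_in_str in Hz. congruence.
Qed.

Lemma app_str l i y : nth_error l i = Some y -> app (str l) (num i) = y.
Proof.
  intros H. eapply app_eq; [apply function_str|]. now apply opair_in_str.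
Qed.

Lemma dom_str l : dom (str l) = num (length l).
Proof.
  apply setof_eq. intros i. split.
  - intros Hi. exists (app (str l) i). eapply opair_app; eauto. apply function_str.
  - intros [y Hy]. apply (proj1 (function_str l)) in Hy.
    destruct Hy as [j [z [Hj E]]]. apply opair_inj in E. now destruct E as [-> _].
Qed.

Lemma omega_rec_num (a : V) (g : V -> V -> V) k :
  omega_rec a g (num k) = nat_rect (fun _ => V) a (fun j v => g (num j) v) k.
Proof.
  set (r := nat_rect (fun _ => V) a (fun j v => g (num j) v)).
  (* The internal function that witnesses the recursion: the list of the values
     at 0, ..., k. *)
  set (l := map r (seq 0 (S k))).
  assert (Hl : forall j, j <= k -> app (str l) (num j) = r j).
  { intros j Hj. apply app_str. unfold l. rewrite nth_error_map.
    rewrite nth_error_seq. destruct (PeanoNat.Nat.ltb_spec j (S k)); [easy|lia]. }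
  apply the_eq.
  - exists (str l). repeat split.
    + change (succ (num k)) with (num (S k)).
      replace (S k) with (length l); [apply function_str|].
      unfold l. now rewrite length_map, length_seq.
    + change (succ (num k)) with (num (S k)).
      replace (S k) with (length l); [apply function_str|].
      unfold l. now rewrite length_map, length_seq.
    + apply (Hl 0). lia.
    + intros i Hi. apply in_num in Hi. destruct Hi as [j [Hj ->]].
      change (succ (num j)) with (num (S j)). rewrite !Hl by lia. easy.
    + apply Hl. lia.
  - intros w [f [Hf [H0 [HS <-]]]].
    assert (H : forall j, j <= k -> app f (num j) = r j).
    { induction j as [|j IH]; intros Hj; [exact H0|].
      simpl. rewrite HS by (apply num_in; lia). now rewrite IH by lia. }
    now apply H.
Qed.

Lemma add_num m n : add (num m) (num n) = num (n + m).
Proof.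
  unfold add. rewrite omega_rec_num. induction n as [|n IH]; simpl; congruence.
Qed.

Lemma letter_str F : letter F = str [F].
Proof.
  apply extensionality. intros p. unfold letter. rewrite in_singleton, in_str. split.
  - intros ->. now exists 0, F.
  - intros [[|[|i]] [y [H ->]]]; simpl in *; congruence.
Qed.

Lemma concat_str l m : concat (str l) (str m) = str (l ++ m).
Proof.
  set (shifted := fun p => exists j y,
    opair j y ∈ str m /\ p = opair (add (dom (str l)) j) y).
  assert (Hs : forall p, shifted p <-> exists i y,
    nth_error m i = Some y /\ p = opair (num (i + length l)) y).
  { intros p. unfold shifted. rewrite dom_str. split.
    - intros [j [y [H ->]]]. pose proof H as H'. apply in_str in H'.
      destruct H' as [i [z [E Ep]]]. apply opair_inj in Ep.
      destruct Ep as [-> ->]. exists i, z. now rewrite add_num.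
    - intros [i [y [H ->]]]. exists (num i), y.
      now rewrite opair_in_str, add_num. }
  assert (Hset : forall p, p ∈ setof shifted <-> shifted p).
  { apply in_setof.
    destruct (separation shifted (str (l ++ m))) as [s E].
    exists s. intros p. rewrite E. split; [easy|]. intros H. split; [|easy].
    apply Hs in H. destruct H as [i [y [H ->]]].
    apply opair_in_str. rewrite nth_error_app2 by lia.
    now replace (i + length l - length l) with i by lia. }
  apply extensionality. intros p. unfold concat. fold shifted.
  rewrite in_cup, Hset, Hs, !in_str. split.
  - intros [[i [y [H ->]]] | [i [y [H ->]]]].
    + exists i, y. split; [|easy]. rewrite nth_error_app1; [easy|].
      apply nth_error_Some. congruence.
    + exists (i + length l), y. split; [|easy]. rewrite nth_error_app2 by lia.
      now replace (i + length l - length l) with i by lia.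
  - intros [i [y [H ->]]]. destruct (PeanoNat.Nat.lt_ge_cases i (length l)) as [C|C].
    + left. exists i, y. now rewrite nth_error_app1 in H.
    + right. exists (i - length l), y. rewrite nth_error_app2 in H by lia.
      split; [easy|]. do 2 f_equal. lia.
Qed.

Lemma concat_all_str t n (ls : nat -> list V) :
  (forall k, k < n -> app t (num k) = str (ls k)) ->
  concat_all t (num n) = str (flat_map ls (seq 0 n)).
Proof.
  intros H. unfold concat_all. rewrite omega_rec_num.
  induction n as [|n IH].
  - apply extensionality. intros p. simpl. rewrite in_str. split.
    + intros Hp. now apply in_empty in Hp.
    + intros [[|i] [y [E _]]]; discriminate.
  - simpl nat_rect. rewrite IH by auto. rewrite H by lia.
    rewrite concat_str, seq_S, flat_map_app. simpl. now rewrite app_nil_r.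
Qed.

(** * Unique readability of Polish notation *)

Variable Sg : signature V.

Lemma arity_num F : symbol Sg F -> exists n, arity Sg F = num n.
Proof. intros H. apply in_omega. now apply arity_omega. Qed.

(** [reads k l] holds when l is a concatenation of k terms.  Instead of nesting
    terms, it runs through l with a counter of the terms still expected: a
    symbol of arity n fulfils one expectation and creates n new ones.
    Uniqueness of parsing then becomes a plain induction. *)
Inductive reads : nat -> list V -> Prop :=
| reads_nil : reads 0 []
| reads_cons k n F l :
    arity Sg F = num n -> reads (n + k) l -> reads (S k) (F :: l).

Lemma reads_app j k l m : reads j l -> reads k m -> reads (j + k) (l ++ m).
Proof.
  intros Hl Hm. induction Hl as [|j n F l HF Hl IH]; simpl; [easy|].
  apply reads_cons with n; [easy|].
  now replace (n + (j + k)) with (n + j + k) by lia.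
Qed.

(** A term is not a proper initial segment of another one.  Both readings see
    the same first letter, hence keep the same counter until it reaches 0. *)
Lemma reads_prefix k l l' r r' :
  reads k l -> reads k l' -> l ++ r = l' ++ r' -> l = l' /\ r = r'.
Proof.
  intros Hl. revert l'. induction Hl as [|k n F l HF Hl IH]; intros l' Hl' E.
  - inversion Hl'; subst. auto.
  - inversion Hl' as [|k' n' F' m HF' Hm]; subst. simpl in E.
    injection E as <- E. rewrite HF in HF'. apply num_inj in HF'. subst n'.
    destruct (IH m Hm E). now subst.
Qed.

Lemma reads_flat_map n (ls : nat -> list V) :
  (forall k, k < n -> reads 1 (ls k)) -> reads n (flat_map ls (seq 0 n)).
Proof.
  induction n as [|n IH]; intros H; [constructor|].
  rewrite seq_S, flat_map_app. simpl. rewrite app_nil_r.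
  replace (S n) with (n + 1) by lia. apply reads_app; auto.
Qed.

Lemma flat_map_reads_inj n (ls ls' : nat -> list V) :
  (forall k, k < n -> reads 1 (ls k)) -> (forall k, k < n -> reads 1 (ls' k)) ->
  flat_map ls (seq 0 n) = flat_map ls' (seq 0 n) ->
  forall k, k < n -> ls k = ls' k.
Proof.
  induction n as [|n IH]; intros H H' E k Hk; [lia|].
  rewrite seq_S, !flat_map_app in E. simpl in E. rewrite !app_nil_r in E.
  apply reads_prefix with (k := n) in E; [|apply reads_flat_map; auto..].
  destruct E as [E1 E2].
  destruct (PeanoNat.Nat.eq_dec k n) as [->|]; [easy|].
  apply IH; auto. lia.
Qed.

(** The inverse of [str]; it turns the values of an internal family of strings
    into a family of lists indexed by nat. *)
Definition letters (s : V) : list V :=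
  epsilon (inhabits []) (fun l => s = str l).

Lemma letters_str l : letters (str l) = l.
Proof.
  apply str_inj. symmetry. unfold letters.
  apply (epsilon_spec (inhabits []) (fun m => str l = str m)). now exists l.
Qed.

Lemma polish_str F t n :
  arity Sg F = num n -> (forall k, k < n -> exists l, app t (num k) = str l) ->
  polish Sg F t =
  str (F :: flat_map (fun k => letters (app t (num k))) (seq 0 n)).
Proof.
  intros HF H. unfold polish. rewrite HF.
  rewrite concat_all_str with (ls := fun k => letters (app t (num k))).
  - now rewrite letter_str, concat_str.
  - intros k Hk. destruct (H k Hk) as [l ->]. now rewrite letters_str.
Qed.

Lemma Tm0_str s : Tm0 Sg s -> exists l, s = str l /\ reads 1 l.
Proof.
  induction 1 as [F t HF Ht _ IH]. destruct (arity_num HF) as [n Hn].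
  rewrite Hn in IH. eexists. split.
  - apply polish_str with (n := n); [easy|]. intros k Hk.
    destruct (IH (num k) (num_in Hk)) as [l [E _]]. eauto.
  - apply reads_cons with n; [easy|]. rewrite PeanoNat.Nat.add_0_r.
    apply reads_flat_map. intros k Hk.
    destruct (IH (num k) (num_in Hk)) as [l [-> Hl]]. now rewrite letters_str.
Qed.

Lemma polish_inj F t F' t' :
  symbol Sg F -> power (Tm0 Sg) (arity Sg F) t ->
  symbol Sg F' -> power (Tm0 Sg) (arity Sg F') t' ->
  polish Sg F t = polish Sg F' t' -> F = F' /\ t = t'.
Proof.
  intros HF [Hf Ht] HF' [Hf' Ht'] E.
  destruct (arity_num HF) as [n Hn]. destruct (arity_num HF') as [n' Hn'].
  rewrite Hn in *. rewrite Hn' in *.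
  assert (A : forall k, k < n -> exists l, app t (num k) = str l /\ reads 1 l).
  { intros k Hk. now apply Tm0_str, Ht, num_in. }
  assert (A' : forall k, k < n' -> exists l, app t' (num k) = str l /\ reads 1 l).
  { intros k Hk. now apply Tm0_str, Ht', num_in. }
  rewrite (polish_str (n := n)), (polish_str (n := n')) in E; try easy.
  2:{ intros k Hk. destruct (A' k Hk) as [l [H _]]. eauto. }
  2:{ intros k Hk. destruct (A k Hk) as [l [H _]]. eauto. }
  apply str_inj in E. injection E as <- E. split; [easy|].
  rewrite Hn in Hn'. apply num_inj in Hn'. subst n'.
  apply function_ext with (num n); auto.
  intros i Hi. apply in_num in Hi. destruct Hi as [k [Hk ->]].
  pose proof (fun H H' => flat_map_reads_inj H H' E Hk) as Ek. simpl in Ek.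
  destruct (A k Hk) as [l [El _]]. destruct (A' k Hk) as [l' [El' _]].
  rewrite El, El', !letters_str in Ek. rewrite El, El'. f_equal. apply Ek.
  - intros j Hj. destruct (A j Hj) as [m [-> Hm]]. now rewrite letters_str.
  - intros j Hj. destruct (A' j Hj) as [m [-> Hm]]. now rewrite letters_str.
Qed.

(** * The evaluation homomorphism and its image *)

(** The graph of the homomorphism from terms to V. *)
Inductive value : V -> V -> Prop :=
| value_op F t a :
    symbol Sg F -> function_on (arity Sg F) t -> function_on (arity Sg F) a ->
    (forall i, i ∈ arity Sg F -> value (app t i) (app a i)) ->
    value (polish Sg F t) (V_op Sg F a).

Lemma value_Tm0 t x : value t x -> Tm0 Sg t.
Proof. induction 1. now constructor. Qed.

(** By unique readability, a string determines the rule instance that gives it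
    a value. *)
Lemma value_unique t x y : value t x -> value t y -> x = y.
Proof.
  intros Hx. revert y. induction Hx as [F t a HF Ht Ha Hv IH]. intros y Hy.
  inversion Hy as [F' t' a' HF' Ht' Ha' Hv' E Ey].
  destruct (polish_inj (F := F') (t := t') (F' := F) (t' := t)) as [-> ->];
    try split; eauto using value_Tm0.
  f_equal. apply function_ext with (arity Sg F); eauto.
Qed.

Definition eval (t : V) : V := the (value t).

Lemma eval_eq t x : value t x -> eval t = x.
Proof. intros H. apply the_eq; [easy|]. intros y Hy. now apply (value_unique Hy). Qed.

Lemma value_eval t : Tm0 Sg t -> value t (eval t).
Proof.
  induction 1 as [F t HF Ht _ IH].
  assert (H : value (polish Sg F t)
                (V_op Sg F (lam (arity Sg F) (fun i => eval (app t i))))).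
  { constructor; auto using function_lam.
    intros i Hi. rewrite app_lam by easy. auto. }
  now rewrite (eval_eq H).
Qed.

Lemma eval_homomorphism : homomorphism (Tm0_algebra Sg) (V_algebra Sg) eval.
Proof.
  split; [easy|]. intros F t HF [Ht Hi]. apply eval_eq. simpl.
  constructor; auto using function_lam.
  intros i Hi'. rewrite app_lam by easy. apply value_eval, Hi, Hi'.
Qed.

Inductive generated : V -> Prop :=
| generated_op F a :
    symbol Sg F -> function_on (arity Sg F) a ->
    (forall i, i ∈ arity Sg F -> generated (app a i)) -> generated (V_op Sg F a).

(** Every homomorphism takes terms to generated sets; conversely [eval] reaches
    all of them, since terms for the arguments of an operation can be chosen
    simultaneously. *)
Lemma omega_sig_generated x : omega_sig Sg x <-> generated x.
Proof.
  split.
  - intros [h [[_ Hh] [t [Ht <-]]]].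
    induction Ht as [F t HF Ht Hi IH].
    specialize (Hh F t HF (conj Ht Hi)). simpl in Hh. rewrite Hh.
    constructor; auto using function_lam.
    intros i Hi'. rewrite app_lam by easy. auto.
  - intros Hx. exists eval. split; [apply eval_homomorphism|].
    induction Hx as [F a HF Ha _ IH].
    set (t := lam (arity Sg F)
                (fun i => the (fun s => Tm0 Sg s /\ eval s = app a i))).
    assert (Ht : forall i, i ∈ arity Sg F ->
                   Tm0 Sg (app t i) /\ eval (app t i) = app a i).
    { intros i Hi. unfold t. rewrite app_lam by easy.
      unfold the. apply epsilon_spec. auto. }
    exists (polish Sg F t). split.
    + constructor; [easy|apply function_lam|]. intros i Hi. now apply Ht.
    + apply eval_eq. constructor; auto; [apply function_lam|].
      intros i Hi. destruct (Ht i Hi) as [H <-]. now apply value_eval.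
Qed.

(** * Tuples and their predecessors *)

Lemma pred_tuple n k x :
  is_tuple (num n) x -> k < n -> pred (num k) x = app x (num k).
Proof.
  intros Hx Hk. unfold pred. destruct excluded_middle_informative as [_|N]; [easy|].
  destruct N. exists (num n). split; [apply in_omega; eauto|].
  split; [easy|]. now apply num_in.
Qed.

Lemma pred_tuple_empty n k x :
  is_tuple (num n) x -> n <= k -> pred (num k) x = empty V.
Proof.
  intros Hx Hk. unfold pred. destruct excluded_middle_informative as [N|_]; [|easy].
  destruct N as [m [Hm [Ht Hkm]]]. apply in_omega in Hm. destruct Hm as [m' ->].
  pose proof (function_domain Hx Ht) as E. change (num (S n) = num (S m')) in E.
  apply num_inj in E. apply in_num in Hkm. destruct Hkm as [j [Hj Ej]].
  apply num_inj in Ej. lia.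
Qed.

Lemma in_G (x y : V) : y ∈ G x <-> exists k, y ∈ pred (num k) x.
Proof.
  unfold G. rewrite in_setof.
  - split.
    + intros [k [Hk Hy]]. apply in_omega in Hk. destruct Hk as [j ->]. eauto.
    + intros [k Hk]. exists (num k). split; [apply in_omega|]; eauto.
  - destruct (@replacement V (fun k p => p = pred k x) (omega V)) as [i Hi];
      [congruence|].
    destruct (union i) as [u Hu]. exists u. intros z. rewrite Hu. split.
    + intros [p [Hp Hz]]. apply Hi in Hp. destruct Hp as [k [Hk ->]]. eauto.
    + intros [k [Hk Hz]]. exists (pred k x). rewrite Hi. eauto.
Qed.

Section Values.

Variables (F a : V) (n : nat).
Hypothesis HF : arity Sg F = num n.

(** In the union that defines [V_op], the last pair has first component n and
    does not interfere with the others, because n ∉ n. *)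
Lemma in_V_op i y :
  opair i y ∈ V_op Sg F a <->
  (i ∈ num n /\ y = cup (G (app a i)) (singleton (app a i))) \/
  (i = num n /\ y = F).
Proof.
  unfold V_op. rewrite in_cup, in_singleton, in_lam, HF. split.
  - intros [[j [Hj E]] | E]; apply opair_inj in E; destruct E as [-> ->]; auto.
  - intros [[Hi ->] | [-> ->]]; eauto.
Qed.

Lemma V_op_tuple : is_tuple (num n) (V_op Sg F a).
Proof.
  split.
  - intros p Hp. assert (exists i y, p = opair i y) as [i [y ->]].
    { unfold V_op in Hp. rewrite in_cup, in_singleton, in_lam in Hp.
      destruct Hp as [[i [_ ->]] | ->]; eauto. }
    exists i, y. split; [|easy]. apply in_succ. apply in_V_op in Hp. tauto.
  - intros i Hi. apply in_succ in Hi. destruct Hi as [Hi | ->].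
    + exists (cup (G (app a i)) (singleton (app a i))). split.
      * apply in_V_op. auto.
      * intros y Hy. apply in_V_op in Hy. destruct Hy as [[_ ->] | [-> _]]; [easy|].
        now apply mem_irrefl in Hi.
    + exists F. split.
      * apply in_V_op. auto.
      * intros y Hy. apply in_V_op in Hy. destruct Hy as [[Hi _] | [_ ->]]; [|easy].
        now apply mem_irrefl in Hi.
Qed.

Lemma V_op_type : app (V_op Sg F a) (num n) = F.
Proof. apply (app_eq V_op_tuple). apply in_V_op. auto. Qed.

Lemma V_op_pred k : k < n ->
  pred (num k) (V_op Sg F a) =
  cup (G (app a (num k))) (singleton (app a (num k))).
Proof.
  intros Hk. rewrite (pred_tuple V_op_tuple Hk). apply (app_eq V_op_tuple).
  apply in_V_op. auto using num_in.
Qed.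

Lemma in_V_op_pred k y : y ∈ pred (num k) (V_op Sg F a) <->
  k < n /\ (y ∈ G (app a (num k)) \/ y = app a (num k)).
Proof.
  destruct (PeanoNat.Nat.lt_ge_cases k n) as [Hk|Hk].
  - rewrite V_op_pred by easy. rewrite in_cup, in_singleton. tauto.
  - rewrite (pred_tuple_empty V_op_tuple Hk). split; [|lia].
    intros H. now apply in_empty in H.
Qed.

Lemma in_G_V_op y : y ∈ G (V_op Sg F a) <->
  exists k, k < n /\ (y ∈ G (app a (num k)) \/ y = app a (num k)).
Proof.
  rewrite in_G. split; intros [k H]; exists k; now apply in_V_op_pred.
Qed.

End Values.

(** * Hereditarily regular tuples *)

(** Everything that membership in D and ON and being no limit require of a
    single tuple; the remaining requirements repeat this for the elements of
    G x, or concern well-foundedness. *)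
Definition regular (x : V) :=
  well_typed Sg x /\ forall k, k ∈ omega V ->
    transitive_at k x /\ directed (pred k x) /\
    (pred k x <> empty V -> exists m, maximal_in (pred k x) m).

Definition hereditarily_regular (x : V) :=
  regular x /\ (forall y, y ∈ G x -> regular y) /\ well_founded_on (G x).

Lemma G_trans (x y z : V) :
  (forall k, k ∈ omega V -> transitive_at k x) -> y ∈ G x -> z ∈ G y -> z ∈ G x.
Proof.
  intros Hx Hy Hz. apply in_G in Hy. destruct Hy as [k Hk]. apply in_G. exists k.
  apply (Hx (num k)) with y; auto. apply in_omega. eauto.
Qed.

(** Being a limit presupposes membership in D, so the hypothesis on the
    elements y of G x can only be used once y itself is seen to be in D.  This
    holds because G y ⊆ G x. *)
Lemma hereditarily_regular_iff x :
  ON Sg x /\ ~ limit Sg x /\ (forall y, y ∈ G x -> ~ limit Sg y) <->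
  hereditarily_regular x.
Proof.
  split.
  - intros [[HD [Hdx [Hdy Hwf]]] [Lx Ly]].
    assert (M : forall y, D Sg y -> ~ limit Sg y -> forall k, k ∈ omega V ->
      pred k y <> empty V -> exists m, maximal_in (pred k y) m).
    { intros y Dy N k Hk Hne. apply NNPP. intros H. apply N. split; eauto. }
    pose proof HD as [Wx [Wy [Tx Ty]]].
    assert (HDy : forall y, y ∈ G x -> D Sg y).
    { intros y Hy. repeat split; auto; intros z Hz; [apply Wy|apply Ty];
        eauto using G_trans. }
    split; [|split; [|easy]].
    + split; [easy|]. intros k Hk. repeat split; auto.
    + intros y Hy. split; [auto|]. intros k Hk. repeat split; auto.
  - intros [[Wx Rx] [Ry Hwf]].
    assert (N : forall y, regular y -> ~ limit Sg y).
    { intros y [_ R] [_ [k [Hk [Hne H]]]]. apply H. now apply R. }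
    split; [|split].
    + split; [|split; [|split]]; [|intros k Hk; now apply Rx| |easy].
      * split; [easy|]. split; [intros y Hy; now apply Ry|].
        split; [intros k Hk; now apply Rx|].
        intros y Hy k Hk. now apply (Ry y).
      * intros y Hy k Hk. now apply (Ry y).
    + apply N. now split.
    + auto.
Qed.

Lemma well_founded_irrefl (x y : V) : well_founded_on (G x) -> y ∈ G x -> ~ y ∈ G y.
Proof.
  intros H Hy Hyy. destruct (H (singleton y)) as [d [Hd N]].
  - intros z Hz. apply in_singleton in Hz. now subst.
  - apply nonempty_iff. exists y. now apply in_singleton.
  - apply in_singleton in Hd. subst d. apply N. exists y. split; [|easy].
    now apply in_singleton.
Qed.

(** The k-th predecessor set of the value of an operation at a is
    G a_k ∪ {a_k}: it has a_k as greatest element, hence is directed, and a_k is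
    maximal in it because a_k ∉ G a_k. *)
Lemma generated_hereditarily_regular x : generated x -> hereditarily_regular x.
Proof.
  induction 1 as [F a HF Ha _ IH]. destruct (arity_num HF) as [n Hn].
  assert (R : forall k, k < n -> hereditarily_regular (app a (num k))).
  { intros k Hk. apply IH. rewrite Hn. now apply num_in. }
  clear IH.
  assert (T : forall k, k < n -> forall y z : V,
    y ∈ G (app a (num k)) \/ y = app a (num k) -> z ∈ G y ->
    z ∈ G (app a (num k))).
  { intros k Hk y z [Hy | ->] Hz; [|easy]. destruct (R k Hk) as [[_ Rk] _].
    apply G_trans with y; auto. intros j Hj. now apply Rk. }
  assert (I : forall k, k < n -> ~ app a (num k) ∈ G (app a (num k))).
  { intros k Hk H. destruct (R k Hk) as [_ [_ W]].
    now apply (well_founded_irrefl W H). }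
  split; [split|split].
  - exists (num n). split; [apply in_omega; eauto|].
    split; [now apply V_op_tuple|]. rewrite V_op_type by easy.
    split; [easy|]. split; [easy|]. intros i Hi.
    apply in_num in Hi. destruct Hi as [k [Hk ->]]. apply nonempty_iff.
    exists (app a (num k)). apply in_V_op_pred with n; auto.
  - intros i Hi. apply in_omega in Hi. destruct Hi as [k ->]. repeat split.
    + intros y Hy z Hz. apply (in_V_op_pred _ Hn) in Hy. destruct Hy as [Hk Hy].
      apply (in_V_op_pred _ Hn). eauto.
    + intros b Hb Hne _. apply nonempty_iff in Hne. destruct Hne as [y Hy].
      pose proof (proj1 (in_V_op_pred _ Hn _ _) (Hb y Hy)) as [Hk _].
      exists (app a (num k)). split.
      * apply (in_V_op_pred _ Hn). auto.
      * intros c Hc. apply Hb, (in_V_op_pred _ Hn) in Hc. unfold mem'. tauto.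
    + intros Hne. apply nonempty_iff in Hne. destruct Hne as [y Hy].
      apply (in_V_op_pred _ Hn) in Hy. destruct Hy as [Hk _].
      exists (app a (num k)). split.
      * apply (in_V_op_pred _ Hn). auto.
      * intros [b [Hb Hm]]. apply (in_V_op_pred _ Hn) in Hb.
        apply (I k Hk). now apply (T k Hk b).
  - intros y Hy. apply (in_G_V_op _ Hn) in Hy. destruct Hy as [k [Hk Hy]].
    destruct (R k Hk) as [Ra [RG _]]. destruct Hy as [Hy | ->]; auto.
  (* Well-foundedness: if an element y of b is not minimal, then b meets G y,
     which lies in a single G a_k, where well-foundedness is known; an element
     minimal in b ∩ G a_k is minimal in b by transitivity. *)
  - intros b Hb Hne. apply nonempty_iff in Hne. destruct Hne as [y Hy].
    destruct (proj1 (in_G_V_op _ Hn _) (Hb y Hy)) as [k [Hk Hyk]].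
    destruct (classic (exists z, z ∈ b /\ mem' z y)) as [[z [Hz Hzy]]|]; [|eauto].
    destruct (separation (fun z => z ∈ G (app a (num k))) b) as [c Hc].
    destruct (R k Hk) as [_ [_ W]]. destruct (W c) as [d [Hd N]].
    + intros w Hw. now apply Hc in Hw.
    + apply nonempty_iff. exists z. apply Hc. split; [easy|]. now apply (T k Hk y).
    + apply Hc in Hd. destruct Hd as [Hd Hdk]. exists d. split; [easy|].
      intros [w [Hw Hwd]]. apply N. exists w. split; [|easy].
      apply Hc. split; [easy|]. apply (T k Hk d); auto.
Qed.

Lemma finite_upair (c d : V) : c <> d -> finite (upair c d).
Proof.
  intros Hcd. exists (num 2), (str [c; d]).
  assert (E0 : app (str [c; d]) (num 0) = c) by now apply app_str.
  assert (E1 : app (str [c; d]) (num 1) = d) by now apply app_str.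
  assert (C : forall i, i ∈ num 2 -> i = num 0 \/ i = num 1).
  { intros i Hi. apply in_num in Hi. destruct Hi as [[|[|k]] [Hk ->]]; auto. lia. }
  split; [apply in_omega; eauto|]. split; [apply (function_str [c; d])|]. split.
  - intros i Hi. apply in_upair. destruct (C i Hi) as [-> | ->]; auto.
  - intros y Hy. apply in_upair in Hy. destruct Hy as [-> | ->].
    + exists (num 0). split; [split; [apply num_in; lia|easy]|].
      intros i [Hi E]. destruct (C i Hi) as [-> | ->]; congruence.
    + exists (num 1). split; [split; [apply num_in; lia|easy]|].
      intros i [Hi E]. destruct (C i Hi) as [-> | ->]; congruence.
Qed.

(** An upper bound of c and m is m itself, by maximality. *)
Lemma directed_maximal (p m c : V) :
  directed p -> maximal_in p m -> c ∈ p -> c ∈ G m \/ c = m.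
Proof.
  intros Hd [Hm Hmax] Hc. destruct (classic (c = m)) as [|Hne]; [now right|left].
  destruct (Hd (upair c m)) as [u [Hu Hb]].
  - intros z Hz. apply in_upair in Hz. destruct Hz; now subst.
  - apply nonempty_iff. exists c. apply in_upair. now left.
  - now apply finite_upair.
  - destruct (Hb m) as [<- | H].
    + apply in_upair. now right.
    + destruct (Hb c) as [H|H]; [apply in_upair; now left|easy|exact H].
    + destruct Hmax. eauto.
Qed.

(** The arguments are the greatest elements of the predecessor sets; these sets
    are then G m ∪ {m} by directedness in one direction and transitivity in the
    other. *)
Lemma regular_V_op x : regular x ->
  exists F a, symbol Sg F /\ function_on (arity Sg F) a /\
    (forall i, i ∈ arity Sg F -> app a i ∈ G x) /\ x = V_op Sg F a.
Proof.
  intros [[n' [Hn' [Hx [HF [EF Hne]]]]] R].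
  apply in_omega in Hn'. destruct Hn' as [n ->].
  set (a := lam (num n) (fun i => the (maximal_in (pred i x)))).
  assert (M : forall k, k < n -> maximal_in (pred (num k) x) (app a (num k))).
  { intros k Hk. unfold a. rewrite app_lam by now apply num_in.
    unfold the. apply epsilon_spec. apply R; [apply in_omega; eauto|].
    now apply Hne, num_in. }
  exists (app x (num n)), a. rewrite EF. split; [easy|].
  split; [apply function_lam|]. split.
  - intros i Hi. apply in_num in Hi. destruct Hi as [k [Hk ->]].
    apply in_G. exists k. now apply M.
  - apply function_ext with (num (S n)); [exact Hx|now apply V_op_tuple|].
    intros i Hi. apply in_num in Hi. destruct Hi as [k [Hk ->]].
    destruct (PeanoNat.Nat.eq_dec k n) as [->|N].
    + now rewrite V_op_type.
    + assert (Hk' : k < n) by lia. clear Hk N.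
      rewrite <- (pred_tuple Hx Hk'), <- (pred_tuple (V_op_tuple a EF) Hk').
      rewrite (V_op_pred a EF Hk').
      destruct (R (num k)) as [T [Hd _]]; [apply in_omega; eauto|].
      apply extensionality. intros c. rewrite in_cup, in_singleton. split.
      * intros Hc. apply (directed_maximal Hd); auto.
      * intros [Hc | ->]; [|now apply M]. apply (T (app a (num k))); [|easy].
        now apply M.
Qed.

(** Induction along the relation, in the form of a minimal element of G x that
    is not generated. *)
Lemma hereditarily_regular_generated x : hereditarily_regular x -> generated x.
Proof.
  intros [Rx [Ry Hwf]].
  assert (H : forall y : V, regular y -> (forall z : V, z ∈ G y -> generated z) -> generated y).
  { intros y R HG. destruct (regular_V_op R) as [F [a [HF [Ha [Hi ->]]]]].
    constructor; auto. }
  apply H; [easy|]. intros y Hy. apply NNPP. intros Ny.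
  destruct (separation (fun z => ~ generated z) (G x)) as [b Hb].
  destruct (Hwf b) as [d [Hd N]].
  - intros z Hz. now apply Hb in Hz.
  - apply nonempty_iff. exists y. now apply Hb.
  - apply Hb in Hd. destruct Hd as [Hd Nd]. apply Nd, H; auto.
    intros z Hz. apply NNPP. intros Nz. apply N. exists z. split; [|exact Hz].
    apply Hb. split; [|easy]. apply G_trans with d; auto.
    intros k Hk. now apply Rx.
Qed.

End Universe.

Theorem theorem16 (V : ZFC) (S : signature V) :
  forall x : V,
    omega_sig S x <->
    (ON S x /\ ~ limit S x /\ forall y : V, y ∈ G x -> ~ limit S y).
Proof.
  intros x. rewrite omega_sig_generated, hereditarily_regular_iff. split.
  - apply generated_hereditarily_regular.
  - apply hereditarily_regular_generated.
Qed.
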